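(* Let $n\ge 1$ and let $\rho_n=(n,n-1,\ldots,2,1)$. For all strict partitions $\lambda,\mu,\nu\subseteq\rho_n$ one has $$D_{\lambda,\mu}^{\nu}=D_{\mu,\lambda}^{\nu}.$$ That is, the product $[\lambda]\star[\mu]=\sum_{\nu\subseteq\rho_n}D_{\lambda,\mu}^{\nu}[\nu]$, on the free module $R_n$ with basis the formal symbols $[\lambda]$ ($\lambda\subseteq\rho_n$ a strict partition), is commutative.
   Context: **Strict partitions and shifted shapes.** A strict partition is $\lambda=(\lambda_1>\lambda_2>\cdots>\lambda_\ell>0)$; put $\ell(\lambda)=\ell$ and $|\lambda|=\sum_i\lambda_i$. Identify $\lambda$ with its shifted shape: row $i$ (from the top) has boxes in matrix positions $(i,j)$ with $i\le j<\lambda_i+i$. If $\mu\subseteq\lambda$ (containment of shifted shapes), $\lambda/\mu$ is the set of boxes of $\lambda$ not in $\mu$; $\lambda=\lambda/\emptyset$ is a straight shape. Boxes $(i,i)$ are diagonal boxes. A diagonal edge of $\lambda/\mu$ is the southern edge of a diagonal box of $\lambda$ (including diagonal boxes of $\lambda$ lying in $\mu$). **Shifted edge labeled tableaux.** $\mathrm{eqShSYT}(\lambda/\mu,N)$ is the set of fillings of the boxes of $\lambda/\mu$ and of the diagonal edges of $\lambda/\mu$ by labels in $[N]=\{1,\ldots,N\}$ such that: (S1) every box of $\lambda/\mu$ contains exactly one label; (S2) each diagonal edge contains a (possibly empty) subset of $[N]$; (S3) each of $1,\ldots,N$ appears exactly once; (S4) labels strictly increase left to right along rows and top to bottom along columns;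 in particular each label on a diagonal edge is strictly larger than all box labels in the same column. **Slides.** An inner corner $c$ of $\lambda/\mu$ is a maximally southeast box of $\mu$ (no box of $\mu$ immediately to its right or immediately below it). For $T\in\mathrm{eqShSYT}(\lambda/\mu,N)$, the slide $\mathrm{shEjdt}_c(T)$ is obtained as follows. Place $\bullet$ in $c$. At each step let $a$ be the label in the box immediately right of $\bullet$ (if any), $b$ the label in the box immediately below $\bullet$ (if any), and, if $\bullet$ is in a diagonal box, $S$ the set of labels on its southern edge (a diagonal box has no box below it). Apply: (J1) if $b<a$, or $b$ exists and $a$ does not: swap $\bullet$ and $b$ ($\bullet$ moves down); (J2) if $a<b$, or $a$ exists and $b$ does not (and, if $\bullet$ is in a diagonal box, $S=\emptyset$): swap $\bullet$ and $a$ ($\bullet$ moves right); (J3') if $\bullet$ is in a diagonal box, $S\neq\emptyset$, $a$ exists and $a<\min S$: swap $\bullet$ and $a$, leaving $S$ in place; (J4') if $\bullet$ is in a diagonal box, $S\ne\emptyset$ and $s:=\min S<a$ (or $a$ does not exist): put $s$ in the box in place of $\bullet$ and replace $S$ by $S\setminus\{s\}$; the slide then ends. Repeat from the new position of $\bullet$ until (J4') has been applied or there are no labels immediately south or east of $\bullet$; then erase $\bullet$ (in the latter case the box it occupies is removed from the shape). **Rectification.** $\mathrm{shEqRect}(T)$ is the straight-shape tableau obtained from $T\in\mathrm{eqShSYT}(\lambda/\mu,N)$ by applying $|\mu|$ successive slides, each time into the southmost inner corner of the current shape (row rectification order). **Structure constants.** $S_\mu$ is the superstandard tableau of shifted shape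 $\mu$: its boxes are filled by $1,2,3,\ldots,|\mu|$ in English reading order (rows top to bottom, each left to right), with no edge labels. Define $$d_{\lambda,\mu}^\nu=\#\{T\in\mathrm{eqShSYT}(\nu/\lambda,|\mu|):\ \mathrm{shEqRect}(T)=S_\mu\}$$ (which is $0$ if $\lambda\not\subseteq\nu$), $\Delta(\nu;\lambda,\mu)=|\lambda|+|\mu|-|\nu|$, $L(\nu;\lambda,\mu)=\ell(\lambda)+\ell(\mu)-\ell(\nu)$, and, for an indeterminate $z$, $$D_{\lambda,\mu}^\nu=2^{L(\nu;\lambda,\mu)-\Delta(\nu;\lambda,\mu)}\,z^{\Delta(\nu;\lambda,\mu)}\,d_{\lambda,\mu}^\nu .$$ (If $\Delta(\nu;\lambda,\mu)<0$ then $d_{\lambda,\mu}^{\nu}=0$ and $D_{\lambda,\mu}^\nu=0$, so $D_{\lambda,\mu}^\nu\in\mathbb{Q}[z]$.) $R_n$ is regarded as a free $\mathbb{Q}[z]$-module and $\star$ is extended bilinearly. *)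

(* Defs.v *)
From HB Require Import structures.
From mathcomp Require Import all_boot all_order all_algebra.

Set Implicit Arguments.
Unset Strict Implicit.
Unset Printing Implicit Defensive.

Import GRing.Theory.

(* Rows, columns and parts are numbered from 0.  All shapes are contained in
   rho n, hence live in the n x n grid of matrix positions. *)

Definition strict_partition (la : seq nat) : bool :=
  sorted gtn la && (0 \notin la).

Definition rho (n : nat) : seq nat := rev (iota 1 n).

(* Row i of either shifted shape starts in column i, so containment of shifted
   shapes is containment of row lengths. *)
Definition subshape (la mu : seq nat) : bool :=
  [forall i : 'I_(size la), nth 0 la i <= nth 0 mu i].

Section Tableaux.

Variable n : nat.

Definition box : finType := ('I_n * 'I_n)%type.

Definition shape (la : seq nat) : {set box} :=
  [set c : box | (c.1 <= c.2) && (c.2 < nth 0 la c.1 + c.1)].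

Definition diagonal (c : box) : bool := c.1 == c.2.

Definition right (c : box) : option box :=
  omap (fun j : 'I_n => (c.1, j)) (insub c.2.+1).

Definition below (c : box) : option box :=
  omap (fun i : 'I_n => (i, c.2)) (insub c.1.+1).

Definition inside (M : {set box}) (o : option box) : bool :=
  if o is Some c then c \in M else false.

Definition inner_corner (M : {set box}) (c : box) : bool :=
  [&& c \in M, ~~ inside M (right c) & ~~ inside M (below c)].

Definition southmost_corner (M : {set box}) : option box :=
  [pick c | inner_corner M c &&
            [forall d, inner_corner M d ==> (d.1 <= c.1)]].

Section Fillings.

Variable N : nat.

(* The element k of 'I_N stands for the label k + 1 of [N].  A filling assigns
   to each box at most one label and to the southern edge of each diagonal box
   (i, i) a set of labels. *)
Definition filling : finType :=
  ({ffun box -> option 'I_N} * {ffun 'I_n -> {set 'I_N}})%type.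

Definition in_box (T : filling) (c : box) : option 'I_N := T.1 c.
Definition on_edge (T : filling) (i : 'I_n) : {set 'I_N} := T.2 i.

Definition boxes_filled (nu la : seq nat) (T : filling) : bool :=
  [forall c, isSome (in_box T c) == (c \in shape nu :\: shape la)].

Definition edges_in_shape (nu : seq nat) (T : filling) : bool :=
  [forall i, ((i, i) \notin shape nu) ==> (on_edge T i == set0)].

Definition labels_once (T : filling) : bool :=
  [forall k : 'I_N,
     #|[set c | in_box T c == Some k]| + #|[set i | k \in on_edge T i]| == 1].

Definition rows_increase (T : filling) : bool :=
  [forall c : box, forall d : box, forall k : 'I_N, forall l : 'I_N,
     [&& in_box T c == Some k, in_box T d == Some l,
         c.1 == d.1 & c.2 < d.2] ==> (k < l)].

Definition columns_increase (T : filling) : bool :=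
  [forall c : box, forall d : box, forall k : 'I_N, forall l : 'I_N,
     [&& in_box T c == Some k, in_box T d == Some l,
         c.2 == d.2 & c.1 < d.1] ==> (k < l)].

Definition edges_increase (T : filling) : bool :=
  [forall c : box, forall k : 'I_N, forall l : 'I_N,
     [&& in_box T c == Some k & l \in on_edge T c.2] ==> (k < l)].

Definition labels_increase (T : filling) : bool :=
  [&& rows_increase T, columns_increase T & edges_increase T].

Definition eqShSYT (nu la : seq nat) : {set filling} :=
  [set T | [&& boxes_filled nu la T, edges_in_shape nu T, labels_once T & labels_increase T]].

Definition min_label (S : {set 'I_N}) : option 'I_N :=
  [pick s in S | [forall t in S, s <= t]].

Definition neighbour (T : filling) (o : option box) : option (box * 'I_N) :=
  obind (fun c => omap (pair c) (in_box T c)) o.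

(* The bullet is in the unlabelled box c and is swapped with the label of d. *)
Definition swap (T : filling) (c d : box) : filling :=
  ([ffun x => if x == c then in_box T d
              else if x == d then None else in_box T x], T.2).

Definition pull_up (T : filling) (c : box) (s : 'I_N) : filling :=
  ([ffun x => if x == c then Some s else in_box T x],
   [ffun i => if i == c.2 then on_edge T i :\ s else on_edge T i]).

(* One move of the bullet from c: the new filling and the new position of the
   bullet, or None when the slide ends. *)
Definition slide_step (T : filling) (c : box) : filling * option box :=
  let S := if diagonal c then on_edge T c.2 else set0 in
  match min_label S, neighbour T (right c), neighbour T (below c) with
  | Some s, Some (r, a), _ =>
      if a < s then (swap T c r, Some r)
      else (pull_up T c s, None)
  | Some s, None, _ => (pull_up T c s, None)
  | None, Some (r, a), Some (u, b) =>
      if b < a then (swap T c u, Some u)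
      else (swap T c r, Some r)
  | None, None, Some (u, _) => (swap T c u, Some u)
  | None, Some (r, _), None => (swap T c r, Some r)
  | None, None, None => (T, None)
  end.

Fixpoint slide_from (m : nat) (T : filling) (c : box) : filling :=
  if m is m'.+1 then
    match slide_step T c with
    | (T', Some d) => slide_from m' T' d
    | (T', None) => T'
    end
  else T.

(* Each move increases the sum of the coordinates of the bullet by one, so 2n
   moves always suffice; see slide_from_stable. *)
Definition shEjdt (c : box) (T : filling) : filling := slide_from (n + n) T c.

(* The state consists of the inner shape and the filling; the outer shape is
   the union of the inner shape and the labelled boxes. *)
Definition rect_step (X : {set box} * filling) : {set box} * filling :=
  if southmost_corner X.1 is Some c then (X.1 :\ c, shEjdt c X.2) else X.

Definition shEqRect (la : seq nat) (T : filling) : filling :=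
  (iter #|shape la| rect_step (shape la, T)).2.

End Fillings.

Definition superstandard (mu : seq nat) : filling (sumn mu) :=
  ([ffun c : box => if c \in shape mu
                    then insub (sumn (take c.1 mu) + (c.2 - c.1)) else None],
   [ffun i => set0]).

Definition d (la mu nu : seq nat) : nat :=
  if subshape la nu then
    #|[set T in eqShSYT (sumn mu) nu la | shEqRect la T == superstandard mu]|
  else 0.

End Tableaux.

Local Open Scope ring_scope.

Definition Delta (nu la mu : seq nat) : int :=
  (sumn la)%:Z + (sumn mu)%:Z - (sumn nu)%:Z.

Definition L (nu la mu : seq nat) : int :=
  (size la)%:Z + (size mu)%:Z - (size nu)%:Z.

(* The indeterminate z is 'X.  When Delta is negative, d vanishes (d_eq0). *)
Definition D (n : nat) (la mu nu : seq nat) : {poly rat} :=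
  if Delta nu la mu is Posz k then
    (2%:Q ^ (L nu la mu - Delta nu la mu) * (d n la mu nu)%:R) *: 'X^k
  else 0.

(* Strict partitions contained in rho n; they have at most n parts, each at
   most n. *)
Definition in_rho (n : nat) (s : n.-bseq 'I_n.+1) : bool :=
  strict_partition (map val s) && subshape (map val s) (rho n).

Definition SP (n : nat) : finType := {s : n.-bseq 'I_n.+1 | in_rho s}.

Definition parts (n : nat) (la : SP n) : seq nat := map val (val la).

Definition R (n : nat) : lmodType {poly rat} := {ffun SP n -> {poly rat}^o}.

Definition basis (n : nat) (la : SP n) : R n := [ffun nu => (nu == la)%:R].

Definition star (n : nat) (x y : R n) : R n :=
  \sum_(la : SP n) \sum_(mu : SP n)
    (x la * y mu) *:
      \sum_(nu : SP n) D n (parts la) (parts mu) (parts nu) *: basis nu.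

Lemma star_basis (n : nat) (la mu : SP n) :
  star (basis la) (basis mu) =
  \sum_(nu : SP n) D n (parts la) (parts mu) (parts nu) *: basis nu.
Proof.
rewrite /star (bigD1 la) //= [X in _ + X]big1 ?addr0 => [|ka /negPf ka_la].
  rewrite (bigD1 mu) //= [X in _ + X]big1 ?addr0 => [|ka /negPf ka_mu].
    by rewrite !ffunE !eqxx mulr1 scale1r.
  by rewrite !ffunE ka_mu mulr0 scale0r.
by apply: big1 => ? _; rewrite !ffunE ka_la mul0r scale0r.
Qed.

Local Close Scope ring_scope.

Lemma nth_rho n i : nth 0 (rho n) i = n - i.
Proof.
rewrite /rho; have [lt_in|le_ni] := ltnP i n; last first.
  rewrite nth_default ?size_rev ?size_iota //.
  by symmetry; apply/eqP; rewrite subn_eq0.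
rewrite nth_rev size_iota // nth_iota; first by rewrite add1n subnSK.
by rewrite subnSK // leq_subr.
Qed.

Lemma parts_surj n (la : seq nat) :
  strict_partition la -> subshape la (rho n) -> exists p : SP n, parts p = la.
Proof.
move=> sla /[dup] ila /forallP sub.
have pos i : i < size la -> 0 < nth 0 la i.
  move=> lti; rewrite lt0n; apply: contraL (mem_nth 0 lti) => /eqP ->.
  by case/andP: sla.
have szla : size la <= n.
  case E: (size la) => [//|m].
  have ltm : m < size la by rewrite E.
  have := leq_trans (pos _ ltm) (sub (Ordinal ltm)).
  by rewrite nth_rho subn_gt0.
pose t := [seq inord x : 'I_n.+1 | x <- la].
have szt : size t <= n by rewrite size_map.
have tE : map val (Bseq szt) = la.
  rewrite /= -map_comp -[RHS]map_id; apply/eq_in_map => x /(nthP 0)[i lti <-] /=.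
  rewrite inordK // ltnS; apply: leq_trans (sub (Ordinal lti)) _.
  by rewrite nth_rho leq_subr.
have tP : in_rho (Bseq szt) by rewrite /in_rho tE sla ila.
by exists (Sub (Bseq szt) tP).
Qed.

Lemma slide_from_stable n N m (T : filling n N) (c : box n) :
  n + n <= m + (c.1 + c.2) -> slide_from m T c = slide_from m.+1 T c.
Proof.
have nbr T' (o : option (box n)) u a :
    @neighbour n N T' o = Some (u, a) -> o = Some u.
  by case: o => //= v; case: (in_box T' v) => //= a' [->].
have step T' (e : box n) :
    if (@slide_step n N T' e).2 is Some u then e.1 + e.2 < u.1 + u.2 else true.
  have up u : right e = Some u \/ below e = Some u -> e.1 + e.2 < u.1 + u.2.
    by case; rewrite /right /below; case: insubP => //= k _ E [<-] /=;
       rewrite E ?addnS ?addSn.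
  rewrite /slide_step; case: (min_label _) => [s|];
    case Er: (neighbour T' (right e)) => [[r a]|];
    case Eb: (neighbour T' (below e)) => [[b ?]|] //=;
    try (case: ifP => _ //=); apply: up;
    solve [left; apply: nbr; eassumption | right; apply: nbr; eassumption].
elim: m T c => [|m IHm] T c le_n.
  have /(leq_ltn_trans le_n) := leq_add (ltn_ord c.1) (ltnW (ltn_ord c.2)).
  by rewrite ltnn.
rewrite [LHS]/= [RHS]/=; have := step T c.
case: (slide_step T c) => T' [u|] //= lt_cu; apply: IHm.
by apply: leq_trans le_n _; rewrite addSnnS leq_add2l.
Qed.

Lemma subshape_nth la mu i : subshape la mu -> nth 0 la i <= nth 0 mu i.
Proof.
move=> /forallP sub; have [lti|?] := ltnP i (size la); last by rewrite nth_default.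
exact: sub (Ordinal lti).
Qed.

Lemma card_shape n la : subshape la (rho n) -> #|shape n la| = sumn la.
Proof.
move=> sub.
have le_rho i : nth 0 la i <= n - i by rewrite -nth_rho subshape_nth.
have -> : sumn la = \sum_(0 <= i < maxn n (size la)) nth 0 la i.
  rewrite (big_cat_nat (leq0n _) (leq_maxr n (size la))) /=.
  rewrite [X in _ + X]big_nat [X in _ + X]big1 ?addn0.
    by rewrite sumnE (big_nth 0).
  by move=> i /andP[? _]; rewrite nth_default.
rewrite (big_cat_nat (leq0n _) (leq_maxl n (size la))) /=.
rewrite [X in _ + X]big_nat [X in _ + X]big1 ?addn0; last first.
  move=> i /andP[le_ni _]; apply/eqP; rewrite -leqn0.
  by apply: leq_trans (le_rho i) _; rewrite leqn0 subn_eq0.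
rewrite big_mkord -sum1_card.
rewrite (eq_bigl (fun c : box n => xpredT c.1 && ((c.1 <= c.2) &&
   (c.2 < nth 0 la c.1 + c.1)))); last by move=> c; rewrite inE.
rewrite -(pair_big_dep xpredT (fun i j : 'I_n => (i <= j) &&
   (j < nth 0 la i + i)) (fun _ _ => 1)) /=.
apply: eq_bigr => i _.
have le_n : nth 0 la i + i <= n.
  by rewrite addnC -leq_subRL // ltnW.
rewrite -(big_mkord (fun j => (i <= j) && (j < nth 0 la i + i)) (fun=> 1)).
rewrite (big_cat_nat (leq0n _) le_n) /= (big_cat_nat (leq0n _) (leq_addl _ _)) /=.
rewrite big_nat_cond big1 ?add0n => [|j]; last first.
  by case/andP=> /andP[_ lt] /andP[]; rewrite leqNgt lt.
rewrite [X in _ + X]big_nat_cond [X in _ + X]big1 ?addn0 => [|j]; last first.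
  by case/andP=> /andP[le _] /andP[_]; rewrite ltnNge le.
rewrite big_nat_cond (eq_bigl (fun j => (i <= j < nth 0 la i + i) && true)).
  by rewrite -big_nat_cond sum_nat_const_nat muln1 addnK.
by move=> j; rewrite andbb andbT.
Qed.

Lemma d_eq0 n la mu nu :
  subshape nu (rho n) -> sumn la + sumn mu < sumn nu -> d n la mu nu = 0.
Proof.
move=> nu_rho lt_nu; rewrite /d; case: ifP => // la_nu.
have la_rho : subshape la (rho n).
  by apply/forallP => i; apply: leq_trans (subshape_nth _ la_nu) _;
     apply: subshape_nth.
apply/eqP; rewrite cards_eq0; apply/eqP/setP => T; rewrite [RHS]inE !inE.
apply/negP => /andP[/and4P[/forallP T1 _ /forallP T3 _] _].
have inj : {in shape n nu :\: shape n la &, injective (in_box T)}.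
  move=> c e c_in _ Tce; apply/eqP; apply: contraT => ce.
  have := T1 c; rewrite c_in; case Tc: (in_box T c) => [k|] // _.
  have : 1 < #|[set x | in_box T x == Some k]|.
    have <- : #|[set c; e]| = 2 by rewrite cards2 ce.
    apply: subset_leq_card; apply/subsetP => x; rewrite !inE.
    by case/orP=> /eqP->; rewrite -?Tce Tc.
  by have /eqP <- := T3 k; rewrite ltnNge leq_addr.
have := subset_leq_card (_ : in_box T @: (shape n nu :\: shape n la)
                             \subset [set Some k | k : 'I_(sumn mu)]).
rewrite card_in_imset // card_imset; last by move=> ? ? [].
rewrite card_ord => le_mu.
have /le_mu : in_box T @: (shape n nu :\: shape n la)
                \subset [set Some k | k : 'I_(sumn mu)].
  apply/subsetP => _ /imsetP[c c_in ->]; have := T1 c; rewrite c_in.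
  by case: (in_box T c) => // k _; apply: imset_f.
rewrite cardsD leqNgt => /negP[].
rewrite ltn_subRL card_shape //; apply: leq_ltn_trans lt_nu.
rewrite leq_add2r -(card_shape la_rho); apply: subset_leq_card.
exact: subsetIr.
Qed.

(* Main.v *)
Require Import Defs.
From mathcomp Require Import all_boot all_order all_algebra.
From mathcomp Require Import zify.

Set Implicit Arguments.
Unset Strict Implicit.
Unset Printing Implicit Defensive.

(** The structure constant [d n la mu nu] counts the fillings T of nu / la that
    rectify to S_mu, where the order of the slides is dictated by S_la.  So the
    rectification of T is half of an infusion of the pair (S_la, T), and the
    theorem holds because infusion is an involution: the other half is a filling
    U of nu / mu that rectifies to S_la when the slides are dictated by S_mu, and
    U gives T back.  No confluence of the slides is needed, and edge labels need
    no separate treatment once slides are expressed as follows.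

    A site is a box or a diagonal edge.  Listing the sites of the labels
    1, 2, ..., N of a filling gives a word; it grows the inner shape, one site at
    a time, into the outer one (lemmas [growth_shape_in] and [eqShSYT_growth]).
    Call two sites linked when they are neighbouring boxes, or a diagonal box and
    its southern edge.  Two consecutive letters of a word may be exchanged unless
    they are linked ([growth_switch]).  The slide of a filling into a box c is the
    passage of the letter c through the word of the filling from left to right,
    where at each letter y the two sites are exchanged unless they are linked; in
    the latter case c stays at its place in the word and y travels on.  This is
    lemma [slide_pass]: the bullet moves exactly at the linked letters, and after
    pulling up an edge label it stays on the edge and moves no more
    ([pass_edge]).

    Rectifying along S_la is then passing the letters of the reading word of la,
    last letter first, through the word of T ([shEqRect_tableau]).  The passages
    form a rectangular array of switches of two letters.  Each switch is its own
    inverse ([switchK]), hence so is the array, with rows and columns exchanged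
    ([infuseK]).  This gives an injection from the words counted by [d n la mu nu]
    to those counted by [d n mu la nu] ([d_leq]).  Finally Delta and L are
    symmetric in la and mu. *)

(** * Infusion of words *)

Lemma map_split (A B : Type) (f : A -> B) (s : seq A) (p : seq B) (x : B) (q : seq B) :
  map f s = p ++ x :: q ->
  exists p' a q', [/\ s = p' ++ a :: q', p = map f p', x = f a & q = map f q'].
Proof.
elim: p s => [|y p IHp] [|b s] //= [Eb Es]; first by exists [::], b, s.
have [p' [a [q' [-> -> -> ->]]]] := IHp _ Es.
by exists (b :: p'), a, q'; rewrite -Eb.
Qed.

Section Infusion.

Variables (X : eqType) (linked : rel X).
Hypothesis linked_sym : symmetric linked.

(** The local rule for a letter x that meets the letter y on its right: the result
    is the new pair of consecutive letters, and the second one travels on. *)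
Definition switch (x y : X) : X * X := if linked x y then (x, y) else (y, x).

(** The letter x passes through w from left to right; the result is the new word
    and the letter that comes out. *)
Fixpoint pass (x : X) (w : seq X) : seq X * X :=
  if w is y :: w' then
    let yx := switch x y in let r := pass yx.2 w' in (yx.1 :: r.1, r.2)
  else ([::], x).

(** The letters of u pass through w one after the other, the last one first; the
    second component collects the letters that come out, in the order of u. *)
Fixpoint infuse (u w : seq X) : seq X * seq X :=
  if u is x :: u' then
    let r := infuse u' w in let s := pass x r.1 in (s.1, s.2 :: r.2)
  else (w, [::]).

Lemma switchK x y : switch (switch x y).1 (switch x y).2 = (x, y).
Proof.
rewrite {2 3}/switch; case: ifP => [xy|nxy] /=; first by rewrite /switch xy.
by rewrite /switch linked_sym nxy.
Qed.

Lemma size_pass x w : size (pass x w).1 = size w.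
Proof. by elim: w x => //= y w IHw x; rewrite IHw. Qed.

Lemma size_infuse1 u w : size (infuse u w).1 = size w.
Proof. by elim: u => //= x u IHu; rewrite size_pass. Qed.

Lemma size_infuse2 u w : size (infuse u w).2 = size u.
Proof. by elim: u => //= x u ->. Qed.

Lemma infuse_nilr u : infuse u [::] = ([::], u).
Proof. by elim: u => //= x u ->. Qed.

(** The array of switches can be evaluated by columns as well as by rows: the first
    letter of the second word travels through all of u before the others. *)
Lemma infuse_consr u y w :
  let s := infuse (infuse u [:: y]).2 w in
  infuse u (y :: w) = ((infuse u [:: y]).1 ++ s.1, s.2).
Proof.
elim: u => [|x u /= IHu] //=; rewrite IHu.
case: (infuse u [:: y]) (size_infuse1 u [:: y]) => -[|z [|? ?]] //= v _.
Qed.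

(** The array with the single row x is undone by the array with the single
    column that comes out. *)
Lemma passK x w : infuse (pass x w).1 [:: (pass x w).2] = ([:: x], w).
Proof.
elim: w x => //= y w IHw x; rewrite IHw /=.
by rewrite switchK.
Qed.

Lemma infuseK u w : infuse (infuse u w).1 (infuse u w).2 = (u, w).
Proof.
elim: u => [|x u IHu] /=; first by rewrite infuse_nilr.
by rewrite infuse_consr passK /= IHu.
Qed.

End Infusion.

(** * Growth words of boxes and diagonal edges *)

Section Words.

Variable n : nat.

(** A box, or the diagonal edge [inr i], the southern edge of the box (i, i). *)
Definition site : finType := (box n + 'I_n)%type.

(** The box e is immediately to the right of c or immediately below it. *)
Definition next_box (c e : box n) : bool :=
  ((c.1 == e.1 :> nat) && (c.2.+1 == e.2 :> nat)) ||
  ((c.2 == e.2 :> nat) && (c.1.+1 == e.1 :> nat)).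

(** The site y is immediately to the right of x or immediately below it. *)
Definition next_site (x y : site) : bool :=
  match x, y with
  | inl c, inl e => next_box c e
  | inl c, inr i => c == (i, i)
  | inr _, _ => false
  end.

(** The sites whose order in a word is forced when they are consecutive.  Two labels on
    the same edge need not be linked, as exchanging equal letters changes nothing. *)
Definition linked (x y : site) : bool := next_site x y || next_site y x.

Lemma linked_sym : symmetric linked.
Proof. by move=> x y; rewrite /linked orbC. Qed.

(** The set of boxes that occur in a word, regardless of edges. *)
Definition boxes (w : seq site) : {set box n} := [set c | inl c \in w].

Arguments boxes : simpl never.

(** The site x can be added to a shape with boxes K: every box of the staircase
    region just before x is in K, and a box x is new.  An edge can be added
    repeatedly, as it carries any number of labels. *)
Definition addable (K : {set box n}) (x : site) : bool :=
  (if x is inl c then (c.1 <= c.2) && (c \notin K) else true) &&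
  [forall d : box n, (d.1 <= d.2) && next_site (inl d) x ==> (d \in K)].

(** The letters of w can be added to K one after the other, from left to right. *)
Fixpoint growth (K : {set box n}) (w : seq site) : bool :=
  if w is x :: w' then addable K x && growth (K :|: boxes [:: x]) w' else true.

Lemma boxes_nil : boxes [::] = set0.
Proof. by apply/setP => c; rewrite !inE. Qed.

Lemma boxes_cat u v : boxes (u ++ v) = boxes u :|: boxes v.
Proof. by apply/setP => c; rewrite !inE mem_cat. Qed.

Lemma boxes_cons x w : boxes (x :: w) = boxes [:: x] :|: boxes w.
Proof. exact: boxes_cat [:: x] w. Qed.

Lemma boxes_perm u v : perm_eq u v -> boxes u = boxes v.
Proof. by move=> /perm_mem uv; apply/setP => c; rewrite !inE uv. Qed.

Lemma growth_cat K u v : growth K (u ++ v) = growth K u && growth (K :|: boxes u) v.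
Proof.
elim: u K => [|x u IHu] K /=; first by rewrite boxes_nil setU0.
by rewrite IHu (boxes_cons x u) setUA andbA.
Qed.

Lemma growth_split K p x q :
  growth K (p ++ x :: q) -> addable (K :|: boxes p) x.
Proof. by rewrite growth_cat /= => /and3P[]. Qed.

Lemma growthP K w :
  (forall p x q, w = p ++ x :: q -> addable (K :|: boxes p) x) -> growth K w.
Proof.
elim: w K => //= x w IHw K Hw; rewrite -[K in addable K]setU0 -boxes_nil.
rewrite (Hw [::] x w) //=; apply: IHw => p y q def_w.
by rewrite -setUA -boxes_cons; apply: (Hw (x :: p) y q); rewrite def_w.
Qed.

Lemma addable_next K (d : box n) x :
  addable K x -> d.1 <= d.2 -> next_site (inl d) x -> d \in K.
Proof. by case/andP=> _ /forallP/(_ d)/implyP H le_d dx; apply: H; rewrite le_d. Qed.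

Lemma growth_switch K x y :
  growth K [:: x; y] ->
  growth K [:: (switch linked x y).1; (switch linked x y).2].
Proof.
rewrite /switch; case: ifP => //= /norP[nxy nyx] /and3P[Kx Ky _].
rewrite andbT; apply/andP; split.
  case/andP: (Ky) => reg_y /forallP fy; apply/andP; split.
    case: (y) reg_y => // c /andP[-> ]; rewrite !inE.
    by case/norP.
  apply/forallP => d; apply/implyP => /andP[le_d dy].
  have := addable_next Ky le_d dy; rewrite !inE => /orP[//|/eqP dx].
  by rewrite -dx dy in nxy.
case/andP: (Kx) => reg_x /forallP fx; apply/andP; split.
  case: (x) reg_x Ky => // c /andP[-> cK]; rewrite !inE (negPf cK) /=.
  case: y {nxy nyx} => // e /andP[/andP[_ + _]]; rewrite !inE.
  by case/norP=> _; apply: contra => /eqP[->].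
apply/forallP => d; apply/implyP => /andP[le_d dx].
by rewrite inE (addable_next Kx le_d dx).
Qed.

Lemma switch_perm x y : perm_eq [:: (switch linked x y).1; (switch linked x y).2] [:: x; y].
Proof. by rewrite /switch; case: ifP => //= _; rewrite (perm_catC [:: y] [:: x]). Qed.

Lemma pass_perm x w : perm_eq (rcons (pass linked x w).1 (pass linked x w).2) (x :: w).
Proof.
elim: w x => //= y w IHw x; have := switch_perm x y.
case: (switch linked x y) => y' x' /= pxy.
apply: (@perm_trans _ (y' :: x' :: w)); first by rewrite perm_cons IHw.
by rewrite -[_ :: _]/([:: y'; x'] ++ w) -[x :: _]/([:: x; y] ++ w) perm_cat2r.
Qed.

Lemma growth_pass K x w :
  growth K (x :: w) -> growth K (rcons (pass linked x w).1 (pass linked x w).2).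
Proof.
elim: w x K => // y w IHw x K.
rewrite -[x :: _]/([:: x; y] ++ w) growth_cat => /andP[/growth_switch].
have := switch_perm x y; rewrite [pass _ _ _]/=.
case: (switch linked x y) => y' x' /boxes_perm <- Kyx Kw.
have : growth K ([:: y'; x'] ++ w) by rewrite growth_cat Kyx.
by rewrite /= => /andP[-> ?]; apply: IHw.
Qed.

Lemma infuse_perm u w :
  perm_eq ((infuse linked u w).1 ++ (infuse linked u w).2) (u ++ w).
Proof.
elim: u => [|x u IHu] /=; first by rewrite cats0.
rewrite -cat_rcons; apply: (@perm_trans _ ((x :: (infuse linked u w).1) ++ (infuse linked u w).2)).
  by rewrite perm_cat2r pass_perm.
by rewrite /= perm_cons.
Qed.

Lemma growth_infuse K u w :
  growth K (u ++ w) -> growth K ((infuse linked u w).1 ++ (infuse linked u w).2).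
Proof.
elim: u K => [|x u IHu] K /=; first by rewrite cats0.
case/andP=> Kx /IHu; rewrite -cat_rcons !growth_cat => /andP[K1 K2].
rewrite growth_pass //= ?Kx //.
by rewrite (boxes_perm (pass_perm _ _)) boxes_cons setUA.
Qed.

Lemma growth_uniq_box K p c q :
  growth K (p ++ inl c :: q) -> [/\ c \notin K, inl c \notin p & inl c \notin q].
Proof.
move=> Kw; have := growth_split Kw => /andP[/andP[_]].
rewrite !inE => /norP[-> ->] _; split=> //; apply/negP => /splitPr cq.
case: cq Kw => q1 q2; rewrite -cat_cons catA => /growth_split/andP[/andP[_]].
by rewrite !inE mem_cat inE eqxx !orbT.
Qed.

(** A site next to the box c cannot precede c, since it requires c. *)
Lemma next_after K p c q x :
  growth K (p ++ inl c :: q) -> next_site (inl c) x -> x \notin p.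
Proof.
move=> Kw cx; have [cK cp _] := growth_uniq_box Kw.
have /andP[/andP[le_c _] _] := growth_split Kw.
apply/negP => /splitPr xp; case: xp Kw cp => p1 p2.
rewrite -catA cat_cons => /growth_split/addable_next Kx cp.
have := Kx _ le_c cx; rewrite !inE (negPf cK) /= => cp1.
by rewrite mem_cat cp1 in cp.
Qed.

End Words.

(** * One move of the bullet *)

Section SlideStep.

Variables n N : nat.
Implicit Types (T : filling n N) (c e f : box n).

Lemma next_boxP c e : reflect (right c = Some e \/ below c = Some e) (next_box c e).
Proof.
case: c e => c1 c2 [e1 e2]; rewrite /next_box /right /below /=.
apply: (iffP orP).
  case=> /andP[/eqP/val_inj <- /eqP E]; [left | right].
    by rewrite E (valK e2).
  by rewrite E (valK e1).
by case; case: insubP => //= u _ E [<- <-]; rewrite eqxx E eqxx; [left | right].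
Qed.

Lemma neighbourP T o f b :
  reflect (o = Some f /\ in_box T f = Some b) (neighbour T o == Some (f, b)).
Proof.
apply: (iffP eqP) => [|[-> /= ->] //].
by case: o => //= g; case E: (in_box T g) => [b'|] //= [<- <-].
Qed.

Lemma min_labelP (S : {set 'I_N}) (s : 'I_N) :
  s \in S -> (forall t : 'I_N, t \in S -> s <= t) -> min_label S = Some s.
Proof.
move=> sS min_s; rewrite /min_label; case: pickP => [t /andP[tS /forallP min_t]|].
  congr Some; apply/val_inj/eqP; rewrite eqn_leq min_s // andbT.
  by have := min_t s; rewrite sS.
move=> /(_ s); rewrite sS /= => /negP[]; apply/forallP => t.
by apply/implyP; apply: min_s.
Qed.

(** The bullet moves to the neighbouring box with the smallest label, if no label
    on the southern edge is smaller. *)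
Lemma slide_step_box T c e (a : 'I_N) :
    e.1 <= e.2 -> next_box c e -> in_box T e = Some a ->
    (forall f (b : 'I_N), next_box c f -> f != e -> in_box T f = Some b -> a < b) ->
    (diagonal c -> forall s : 'I_N, s \in on_edge T c.2 -> a < s) ->
  slide_step T c = (swap T c e, Some e).
Proof.
move=> le_e ce Te box_lt edge_lt; rewrite /slide_step.
set S := if _ then _ else _; set nr := neighbour T (right c).
set nb := neighbour T (below c).
have S_lt s : min_label S = Some s -> a < s.
  rewrite /min_label; case: pickP => // t /andP[+ _] [<-].
  by rewrite /S; case: ifP => [/edge_lt/(_ t) //|]; rewrite inE.
have nr_lt f b : nr = Some (f, b) -> f != e -> a < b.
  move=> /eqP/neighbourP[cf Tf] fe; apply: box_lt fe Tf.
  by apply/next_boxP; left.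
have nb_lt f b : nb = Some (f, b) -> f != e -> a < b.
  move=> /eqP/neighbourP[cf Tf] fe; apply: box_lt fe Tf.
  by apply/next_boxP; right.
case/next_boxP: (ce) => cE.
  have Er : nr = Some (e, a) by rewrite /nr cE /= Te.
  have nbe f b : nb = Some (f, b) -> f != e.
    move=> /eqP/neighbourP[cf _]; apply/eqP => fe; subst f.
    move: cE cf; rewrite /right /below.
    case: insubP => //= i _ Ei [<-]; case: insubP => //= j _ Ej [] _ Eci.
    by move: Ei; rewrite -Eci; lia.
  rewrite Er; case Es: (min_label S) => [s|]; first by rewrite S_lt.
  case Eb: nb => [[f b]|] //.
  by rewrite ltnNge ltnW // (nb_lt _ _ Eb) // (nbe _ _ Eb).
have Eb : nb = Some (e, a) by rewrite /nb cE /= Te.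
have S0 : min_label S = None.
  suff -> : S = set0 by rewrite /min_label; case: pickP => // t; rewrite inE.
  rewrite /S /diagonal; case: eqP => // c12; move: cE le_e; rewrite /below.
  by case: insubP => //= i _ Ei [<-] /=; rewrite Ei -c12 ltnn.
have nre f b : nr = Some (f, b) -> f != e.
  move=> /eqP/neighbourP[cf _]; apply/eqP => fe; subst f.
  move: cf cE; rewrite /right /below.
  case: insubP => //= i _ Ei [<-]; case: insubP => //= j _ Ej [] _ Eci.
  by move: Ei; rewrite -Eci; lia.
rewrite S0 Eb; case Er: nr => [[f b]|] //.
by rewrite (nr_lt _ _ Er) // (nre _ _ Er).
Qed.

(** The smallest label of the southern edge is pulled up when it is smaller than
    the neighbouring labels. *)
Lemma slide_step_edge T c (s : 'I_N) :
    diagonal c -> s \in on_edge T c.2 ->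
    (forall t : 'I_N, t \in on_edge T c.2 -> s <= t) ->
    (forall f (b : 'I_N), next_box c f -> in_box T f = Some b -> s < b) ->
  slide_step T c = (pull_up T c s, None).
Proof.
move=> c_diag sS min_s box_lt; rewrite /slide_step c_diag (min_labelP sS min_s).
case Er: (neighbour T (right c)) => [[f b]|] //.
move/eqP/neighbourP: Er => [cf Tf]; rewrite ltnNge ltnW //.
by apply: box_lt Tf; apply/next_boxP; left.
Qed.

Lemma slide_step_stop T c :
    (forall f, next_box c f -> in_box T f = None) ->
    (diagonal c -> on_edge T c.2 = set0) ->
  slide_step T c = (T, None).
Proof.
move=> no_box no_edge; rewrite /slide_step.
have -> : (if diagonal c then on_edge T c.2 else set0) = set0 by case: ifP.
have -> : @min_label N set0 = None by rewrite /min_label; case: pickP => // t; rewrite inE.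
have nb f : next_box c f -> neighbour T (Some f) = None by move=> /no_box /= ->.
case Er: (right c) => [r|] /=; last first.
  by case Eb: (below c) => [u|] //; rewrite nb //; apply/next_boxP; right.
rewrite no_box /=; last by apply/next_boxP; left.
by case Eb: (below c) => [u|] //; rewrite nb //; apply/next_boxP; right.
Qed.

End SlideStep.

(** * Slides of fillings as passages through words *)

Section Tableau.

Variable n : nat.
Implicit Types (w p q : seq (site n)) (c e : box n) (K : {set box n}).

(** The filling whose label k is at the k-th site of w, for w of size N.  A box that
    does not occur in w has index N, which is no label; it is left empty. *)
Definition tableau N w : filling n N :=
  ([ffun c => insub (index (inl c : site n) w)],
   [ffun i => [set k : 'I_N | nth (inr i : site n) w k == inr i]]).

Lemma in_tableau N w c (k : 'I_N) x0 :
  size w = N -> in_box (tableau N w) c = Some k ->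
  index (inl c : site n) w = k /\ nth x0 w k = inl c.
Proof.
move=> sz; rewrite /in_box ffunE; case: insubP => // k' lt_k /= Ek [<-]; split=> //.
by rewrite Ek nth_index // -index_mem sz.
Qed.

Lemma on_tableau N w i (k : 'I_N) x0 :
  size w = N -> (k \in on_edge (tableau N w) i) = (nth x0 w k == inr i).
Proof. by move=> sz; rewrite /on_edge ffunE inE (set_nth_default x0) ?sz. Qed.

(** Labels next to the bullet c, when c would be inserted in the word after p, are at
    least the size of p; so only the letters after p can make the bullet move. *)
Lemma box_after N K p c q e (b : 'I_N) :
  growth K (p ++ inl c :: q) -> size (p ++ q) = N ->
  next_box c e -> in_box (tableau N (p ++ q)) e = Some b ->
  b = size p + index (inl e : site n) q :> nat.
Proof.
move=> Kw sz ce /(in_tableau (inl c) sz)[<- _]; rewrite index_cat.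
by rewrite (negPf (next_after Kw (_ : next_site _ (inl e)))).
Qed.

Lemma edge_after N K p i q (k : 'I_N) :
  growth K (p ++ inl (i, i) :: q) -> size (p ++ q) = N ->
  k \in on_edge (tableau N (p ++ q)) i -> size p <= k.
Proof.
move=> Kw sz; rewrite (on_tableau _ _ (inl (i, i)) sz) nth_cat.
case: ltnP => // lt_k /eqP Ek.
have := next_after Kw (eqxx _ : next_site (inl (i, i)) (inr i)).
by rewrite -Ek mem_nth.
Qed.

Lemma swap_tableau N K p c e q :
  growth K (p ++ inl c :: inl e :: q) -> size p + (size q).+1 = N ->
  swap (tableau N (p ++ inl e :: q)) c e = tableau N (p ++ inl c :: q).
Proof.
move=> Kw sz; have [cK cp cq] := growth_uniq_box Kw.
move: (Kw); rewrite -cat_rcons => Kw'; have [eK ep eq] := growth_uniq_box Kw'.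
move: cq ep; rewrite in_cons mem_rcons in_cons !negb_or => /andP[ce cq] /andP[_ ep].
have nce : (c == e) = false by apply/negP => /eqP E; rewrite E eqxx in ce.
congr pair; apply/ffunP => x; rewrite ffunE.
  rewrite [RHS]ffunE /in_box !ffunE /= !index_cat /=.
  have E (f g : box n) : (inl f == inl g :> site n) = (f == g) by [].
  rewrite !E; have [->|xc] := eqVneq x c.
    by rewrite (negPf ep) (negPf cp) !eqxx.
  have [->|xe] := eqVneq x e; last by [].
  rewrite (negPf ep) insubF //; apply/negbTE; rewrite -leqNgt.
  by rewrite -sz leq_add2l ltnS leqNgt index_mem.
rewrite /= !ffunE; apply/setP => k; rewrite !inE !nth_cat.
by case: ltnP => // _; case: (k - size p).
Qed.

Lemma pull_tableau N K p i q (s : 'I_N) :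
  growth K (p ++ inl (i, i) :: inr i :: q) -> size p + (size q).+1 = N ->
  s = size p :> nat ->
  pull_up (tableau N (p ++ inr i :: q)) (i, i) s = tableau N (p ++ inl (i, i) :: q).
Proof.
move=> Kw sz Es; have [cK cp cq] := growth_uniq_box Kw.
congr pair; apply/ffunP => x; rewrite ffunE.
  rewrite [RHS]ffunE /in_box !ffunE /= !index_cat /=.
  have E (f g : box n) : (inl f == inl g :> site n) = (f == g) by [].
  rewrite !E; have [->|xc] := eqVneq x (i, i).
    rewrite (negPf cp) addn0; case: insubP => [u _ Eu|].
      by congr Some; apply: val_inj; rewrite Eu.
    by rewrite -Es ltn_ord.
  by [].
rewrite [RHS]ffunE /on_edge ffunE /=.
have [->|xi] := eqVneq x i; apply/setP => k; rewrite !inE !nth_cat.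
  have [->|nks] := eqVneq k s; first by rewrite Es ltnn subnn.
  have : k != s :> nat by [].
  rewrite Es; case: ltngtP => // lt_k _.
  by rewrite -(subnSK lt_k).
case: ltnP => // _; case: (k - size p) => //=.
have -> : (inr i == inr x :> site n) = (i == x) by [].
by rewrite eq_sym (negPf xi).
Qed.

(** A letter coming out of the bullet box onto the edge no longer affects the
    word: the slide has ended.  Indeed the only box linked to the edge is already
    in the shape. *)
Lemma pass_edge K i q :
  (i, i) \in K -> growth K q -> (pass (@linked n) (inr i) q).1 = q.
Proof.
elim: q K => //= y q IHq K iK /andP[Ky Kq]; rewrite /switch.
have iK' : (i, i) \in K :|: boxes [:: y] by rewrite inE iK.
case: ifP => [|_] /=; last by rewrite (IHq _ iK' Kq).
case: y Ky {Kq iK'} => [c|j] // /andP[/andP[_ cK] _] /eqP Ec.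
by rewrite Ec iK in cK.
Qed.

(** Here p is the part of the word that the bullet c has already passed.  The
    slide only moves at letters linked to c; all other letters are exchanged with
    c and leave the filling and the bullet unchanged. *)
Lemma slide_pass N K m p c q :
  growth K (p ++ inl c :: q) -> size p + size q = N -> n + n <= m + (c.1 + c.2) ->
  slide_from m (tableau N (p ++ q)) c =
  tableau N (p ++ (pass (@linked n) (inl c) q).1).
Proof.
elim: q m p c => [|y q IHq] m p c Kw sz le_m.
  suff stop : slide_step (tableau N (p ++ [::])) c = (tableau N (p ++ [::]), None).
    by case: m {le_m} => //= m; rewrite stop.
  have sz' : size (p ++ [::]) = N by rewrite size_cat.
  apply: slide_step_stop => [f cf|c_diag].
    case Tf: (in_box _ f) => [b|] //; have := ltn_ord b.
    by rewrite (box_after Kw sz' cf Tf) -[X in _ < X]sz /= ltnn.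
  apply/setP => s; rewrite [RHS]inE; apply/negP; case: c c_diag {le_m} Kw => i j /= /eqP /= -> Kw.
  by move/(edge_after Kw sz'); rewrite leqNgt -[X in _ < X]addn0 sz ltn_ord.
rewrite [pass _ _ _]/= /switch; case: ifP => [|ncy]; last first.
  rewrite -cat_rcons -[in RHS]cat_rcons; apply: IHq => //.
    have := Kw; rewrite -[_ :: _]/([:: inl c; y] ++ q) catA growth_cat.
    rewrite growth_cat => /andP[/andP[Kp /growth_switch]].
    rewrite /switch ncy => Kcy Kq.
    rewrite -cats1 -catA -[[:: y] ++ _]/([:: y; inl c] ++ q) catA growth_cat.
    rewrite growth_cat Kp Kcy /=; apply: etrans Kq; congr (growth (_ :|: _) _).
    by apply: boxes_perm; rewrite perm_cat2l (perm_catC [:: y] [:: inl c]).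
  by rewrite size_rcons addSn -addnS.
rewrite [(inl c, y).1]/= [(inl c, y).2]/=.
have [le_c sz'] : c.1 <= c.2 /\ size (p ++ y :: q) = N.
  by split; [case/andP: (growth_split Kw) => /andP[] | rewrite size_cat].
have Kyq : growth K (rcons p (inl c) ++ y :: q) by rewrite cat_rcons.
have Ky := growth_split Kyq.
have lt_p : size p < N by rewrite -sz /=; lia.
case/orP=> [cy|yc]; last first.
  (* The bullet box was addable before y, so y cannot lie next to and before it. *)
  case: y Ky yc Kw {Kyq sz sz'} => // e /andP[/andP[le_e eK] _] ec Kw.
  have := addable_next (growth_split Kw) le_e ec.
  by move: eK; rewrite !inE mem_rcons in_cons !negb_or => /and3P[/negPf-> _ /negPf->].
case: m le_m => [|m] le_m.
  by have := ltn_ord c.1; have := ltn_ord c.2; lia.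
case: y Kw sz sz' Kyq Ky cy => [e|i] Kw sz sz' Kyq Ky cy.
  have /andP[/andP[le_e eK] _] := Ky.
  have ep : inl e \notin p := next_after Kw cy.
  have Te : in_box (tableau N (p ++ inl e :: q)) e = Some (Ordinal lt_p).
    by rewrite /in_box ffunE index_cat (negPf ep) /= eqxx addn0 insubT.
  have step := slide_step_box le_e cy Te.
  rewrite /= step {step}; first last.
  - case: c cy le_c {le_m} Kw Kyq Ky eK => i j cy le_c Kw Kyq Ky eK /= /eqP /= Eij.
    subst j => s sS; rewrite ltn_neqAle (edge_after Kw sz') ?andbT //.
    apply/eqP => Es; move: sS; rewrite (on_tableau _ _ (inl e) sz') -Es.
    by rewrite nth_cat ltnn subnn.
  - move=> f b cf fe Tf; rewrite (box_after Kw sz' cf Tf) /=.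
    have -> : (inl e == inl f :> site n) = (e == f) by [].
    by rewrite eq_sym (negPf fe) -addSnnS leq_addr.
  rewrite (swap_tableau Kw) // -!(cat_rcons (inl c)); apply: IHq => //.
    by rewrite size_rcons addSn -addnS.
  by move: cy => /orP[] /andP[/eqP E1 /eqP E2]; rewrite -?E1 -E2 -?E1; lia.
case: c cy Kw Kyq Ky {le_m le_c} => i1 i2 /eqP[-> ->] Kw Kyq Ky.
rewrite /= (@slide_step_edge _ _ _ (i, i) (Ordinal lt_p) (eqxx i)) //; first last.
- move=> f b cf Tf; rewrite (box_after Kw sz' cf Tf) /= -addSnnS leq_addr //.
- by move=> t; apply: edge_after Kw sz'.
- by rewrite (on_tableau _ _ (inr i) sz') nth_cat ltnn subnn.
rewrite /= (pull_tableau Kw) //; congr (tableau N (p ++ _ :: _)).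
move: Kw; rewrite -[_ :: _]/([:: inl (i, i); inr i] ++ q) catA growth_cat.
case/andP=> _ Kq; rewrite (pass_edge _ Kq) //.
by rewrite !inE mem_cat inE eqxx !orbT.
Qed.

Lemma shEjdt_tableau N K c q :
  growth K (inl c :: q) -> size q = N ->
  shEjdt c (tableau N q) = tableau N (pass (@linked n) (inl c) q).1.
Proof. by move=> Kw sz; apply: (slide_pass (p := [::]) Kw) => //; rewrite leq_addr. Qed.

End Tableau.

(** * Shapes and their reading words *)

(* The name shape also denotes the sequence of sizes of a sequence of sequences. *)
Local Notation shape := Defs.shape.

Section Shapes.

Variable n : nat.
Implicit Types (c e : box n) (la mu nu : seq nat) (w p q : seq (site n)).

Lemma box_eq c e : c.1 = e.1 :> nat -> c.2 = e.2 :> nat -> c = e.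
Proof. by case: c e => c1 c2 [e1 e2] /= /val_inj -> /val_inj ->. Qed.

(** K contains every box of the staircase region just before a box of K. *)
Definition lower_closed (K : {set box n}) : Prop :=
  forall c e, c.1 <= c.2 -> next_box c e -> e \in K -> c \in K.

Lemma lower_closed_growth (K : {set box n}) w :
  lower_closed K -> growth K w -> lower_closed (K :|: boxes w).
Proof.
elim: w K => [|x w IHw] K clK /=; first by rewrite boxes_nil setU0.
case/andP=> Kx Kw; rewrite boxes_cons setUA; apply: IHw Kw => c e le_c ce.
rewrite !inE => /orP[/(clK _ _ le_c ce) -> //|/eqP xe].
by rewrite (addable_next Kx le_c) // -xe.
Qed.

Lemma lower_closed_le (K : {set box n}) c e :
    lower_closed K -> e \in K -> e.1 <= e.2 ->
    c.1 <= c.2 -> c.1 <= e.1 -> c.2 <= e.2 ->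
  c \in K.
Proof.
move=> clK; move: {2}(e.1 + e.2) (leqnn (e.1 + e.2)) => m.
elim: m e => [|m IHm] e le_m eK le_e le_c le1 le2.
  by rewrite (@box_eq c e) //; lia.
case: (ltngtP c.1 e.1) le1 => // [lt1 _|eq1 _]; last first.
  case: (ltngtP c.2 e.2) le2 => // [lt2 _|eq2 _]; last by rewrite (box_eq eq1 eq2).
  have lt_n : e.2.-1 < n by apply: leq_ltn_trans (leq_pred _) (ltn_ord _).
  have [le_f le_m'] : e.1 <= e.2.-1 /\ e.1 + e.2.-1 <= m by lia.
  have [le1 le2] : c.1 <= e.1 /\ c.2 <= e.2.-1 by lia.
  apply: (IHm (e.1, Ordinal lt_n)) => //; apply: (clK _ e) => //.
  by rewrite /next_box /= eqxx (ltn_predK lt2) eqxx.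
have lt_n : e.1.-1 < n by apply: leq_ltn_trans (leq_pred _) (ltn_ord _).
have [le_f le_m'] : e.1.-1 <= e.2 /\ e.1.-1 + e.2 <= m by lia.
have le1 : c.1 <= e.1.-1 by lia.
apply: (IHm (Ordinal lt_n, e.2)) => //; apply: (clK _ e) => //.
by rewrite /next_box /= eqxx (ltn_predK lt1) eqxx orbT.
Qed.

Lemma strict_partition_ltn la i :
  strict_partition la -> 0 < nth 0 la i.+1 -> nth 0 la i.+1 < nth 0 la i.
Proof.
case/andP=> s_la _ pos; have lt_i : i.+1 < size la.
  by rewrite ltnNge; apply: contraL pos => ?; rewrite nth_default.
have gtn_trans : transitive gtn by move=> a b c ba cb; apply: ltn_trans cb ba.
by apply: (sorted_ltn_nth gtn_trans 0 s_la); rewrite ?inE //; apply: ltnW.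
Qed.

Lemma lower_closed_shape la : strict_partition la -> lower_closed (shape n la).
Proof.
move=> s_la c e le_c; rewrite /next_box !inE le_c => /orP[]/andP[/eqP E /eqP S] /andP[le_e lt_e].
  by rewrite E; lia.
rewrite E; move: lt_e (@strict_partition_ltn la c.1 s_la); rewrite -S; lia.
Qed.

Lemma subshapeP la mu :
    strict_partition la -> subshape la (rho n) ->
  subshape la mu = (shape n la \subset shape n mu).
Proof.
move=> /andP[_ la0] la_rho; apply/idP/subsetP => [la_mu c|sub].
  rewrite !inE => /andP[-> lt_c]; apply: leq_trans lt_c _.
  by rewrite leq_add2r subshape_nth.
apply/forallP => i; set m := nth 0 la i.
have m_gt0 : 0 < m.
  by rewrite lt0n; apply: contraNneq la0 => <-; rewrite mem_nth.
have := subshape_nth i la_rho; rewrite nth_rho -/m => le_m.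
have lt1 : i < n by lia.
have lt2 : m.-1 + i < n by lia.
have := sub (Ordinal lt1, Ordinal lt2); rewrite !inE /= -/m; lia.
Qed.

(** The rank of a box in the reading order of the whole grid. *)
Definition place c : nat := c.1 * n + c.2.

Lemma placeP c e : place c < place e = (c.1 < e.1) || (c.1 == e.1 :> nat) && (c.2 < e.2).
Proof.
rewrite /place.
move: (ltn_ord c.2) (ltn_ord e.2); case: (ltngtP c.1 e.1) => /= [lt|lt|->] lt1 lt2.
- by apply/idP; nia.
- by apply/negbTE; rewrite -leqNgt; nia.
- by rewrite ltn_add2l.
Qed.

Lemma place_inj : injective place.
Proof.
move=> c e E; have := placeP c e; have := placeP e c; rewrite E ltnn.
by move=> ? ?; apply: box_eq; lia.
Qed.

(** The boxes of a shape, rows from top to bottom and each from left to right. *)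
Definition reading_boxes la : seq (box n) := sort (relpre place leq) (enum (shape n la)).

(** The word of the superstandard tableau, see [superstandard_reading]. *)
Definition reading la : seq (site n) := map inl (reading_boxes la).

Lemma mem_reading_boxes la c : (c \in reading_boxes la) = (c \in shape n la).
Proof. by rewrite mem_sort mem_enum. Qed.

Lemma boxes_reading la : boxes (reading la) = shape n la.
Proof.
apply/setP => c; rewrite [LHS]inE mem_map; last by move=> ? ? [].
exact: mem_reading_boxes.
Qed.

Lemma size_reading_boxes la : subshape la (rho n) -> size (reading_boxes la) = sumn la.
Proof. by move=> la_rho; rewrite size_sort -cardE card_shape. Qed.

Lemma size_reading la : subshape la (rho n) -> size (reading la) = sumn la.
Proof. by move=> la_rho; rewrite size_map size_reading_boxes. Qed.

Lemma sorted_reading la : sorted (relpre place ltn) (reading_boxes la).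
Proof.
rewrite -sorted_map ltn_sorted_uniq_leq map_inj_uniq; last exact: place_inj.
rewrite sort_uniq enum_uniq sorted_map sort_sorted //.
by move=> c e; apply: leq_total.
Qed.

Lemma reading_split la p x q :
  reading la = p ++ x :: q ->
  exists2 c, x = inl c & c \in shape n la /\
    boxes p = [set e in shape n la | place e < place c].
Proof.
rewrite /reading => E; have [p' [c [q' [Es -> -> _]]]] := map_split E; exists c => //; split.
  by rewrite -mem_reading_boxes Es mem_cat mem_head orbT.
have tr : transitive (relpre place ltn) by move=> a b d; apply: ltn_trans.
have := sorted_reading la; rewrite (sorted_pairwise tr) Es pairwise_cat.
case/and3P=> /allrelP pc _ /= /andP[/allP cq _].
apply/setP => e; rewrite !inE mem_map; last by move=> ? ? [].
have := mem_reading_boxes la e; rewrite inE => <-.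
rewrite Es mem_cat in_cons; case ep: (e \in p') => /=.
  by rewrite (pc e c ep (mem_head _ _) : place e < place c).
have [->|_] /= := eqVneq e c; first by rewrite ltnn.
by case eq: (e \in q') => //; have := cq e eq => /= lt; rewrite ltnNge ltnW.
Qed.

Lemma growth_reading la : strict_partition la -> growth set0 (reading la).
Proof.
move=> s_la; apply: growthP => p x q /reading_split[c -> [c_la ->]]; rewrite set0U.
rewrite /addable !inE ltnn andbF andbT; apply/andP; split.
  by move: c_la; rewrite inE => /andP[].
apply/forallP => e; apply/implyP => /andP[le_e ec].
have := lower_closed_shape s_la le_e ec c_la; rewrite !inE => -> /=.
by rewrite placeP; move: ec; rewrite /next_site /next_box; lia.
Qed.

Lemma boxes_rcons p c : boxes (rcons p (inl c)) = c |: boxes p.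
Proof. by apply/setP => e; rewrite !inE mem_rcons in_cons. Qed.

(** Removing southmost corners one by one removes the boxes of a shape in the reverse
    of the reading order. *)
Lemma southmost_reading la p c q :
  reading la = p ++ inl c :: q ->
  southmost_corner (boxes (rcons p (inl c))) = Some c.
Proof.
case/reading_split=> _ [<-] [c_la]; rewrite boxes_rcons => ->.
set M := _ |: _; have memM e : e \in M = (e \in shape n la) && (place e <= place c).
  rewrite !inE (leq_eqVlt (place e)) (inj_eq place_inj); case: eqP => [->|] //=.
  by move: c_la; rewrite inE => ->.
(* M is an initial segment of the shape in reading order, so c is a corner, no row
   below that of c meets M, and any other box of M in that row has its right
   neighbour in M. *)
have corner_c : inner_corner M c.
  rewrite /inner_corner memM c_la leqnn /=; apply/andP; split.
    case E: (right c) => [e|] //=; rewrite memM negb_and -ltnNge placeP.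
    have : next_box c e by apply/next_boxP; left.
    by rewrite /next_box; lia.
  case E: (below c) => [e|] //=; rewrite memM negb_and -ltnNge placeP.
  have : next_box c e by apply/next_boxP; right.
  by rewrite /next_box; lia.
have le1 e : e \in M -> e.1 <= c.1.
  by rewrite memM leqNgt placeP => /andP[_]; lia.
rewrite /southmost_corner; case: pickP => [e /andP[/and3P[eM nr _] /forallP south]|].
  congr Some; have ec1 : e.1 = c.1 :> nat.
    by apply/eqP; rewrite eqn_leq le1 //=; have := south c; rewrite corner_c.
  move: (eM); rewrite memM => /andP[e_la]; rewrite leqNgt placeP ec1 eqxx ltnn orFb andTb.
  rewrite -leqNgt leq_eqVlt => /orP[/eqP ec2|lt2].
    exact: box_eq.
  have lt_n : e.2.+1 < n by apply: leq_ltn_trans lt2 (ltn_ord _).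
  have [le_r lt_r] : e.1 <= e.2.+1 /\ e.2.+1 < nth 0 la e.1 + e.1.
    by move: e_la c_la; rewrite !inE ec1; lia.
  case/negP: nr; rewrite /right insubT /= memM; apply/andP; split.
    by rewrite inE; apply/andP.
  by rewrite /place /= ec1 leq_add2l.
move=> /(_ c); rewrite corner_c /= => /negP[]; apply/forallP => e.
by apply/implyP => /and3P[/le1].
Qed.

Lemma iter_rect_step N la p u w :
    p ++ u = reading la -> growth set0 (p ++ u ++ w) -> size w = N ->
  iter (size u) (@rect_step n N) (boxes (p ++ u), tableau N w) =
    (boxes p, tableau N (infuse (@linked n) u w).1).
Proof.
elim: u p => [|x u IHu] p Ela Kw sz; first by rewrite cats0.
have [c Ex _] := reading_split (esym Ela); subst x.
rewrite [LHS]/= -cat_rcons IHu ?cat_rcons //.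
rewrite /rect_step /= (southmost_reading (esym Ela)).
move: Kw; rewrite -cat_rcons growth_cat set0U => /andP[Kp /growth_infuse].
rewrite growth_cat => /andP[Kw _]; congr pair.
  move: Kp; rewrite -cats1 => /growth_uniq_box[_ cp _].
  apply/setP => e; rewrite cats1 boxes_rcons !inE; case: eqP => [->|] //=.
  by apply/esym/negbTE.
apply: (@shEjdt_tableau n N (boxes p)); rewrite ?size_infuse1 //.
have := Kp; rewrite -cats1 growth_cat set0U => /andP[_ /andP[Kc _]].
by rewrite /= Kc; congr (growth _ _): Kw; rewrite boxes_rcons setUC; apply/setP => e; rewrite !inE.
Qed.

Lemma shEqRect_tableau N la w :
    subshape la (rho n) -> growth set0 (reading la ++ w) -> size w = N ->
  shEqRect la (tableau N w) = tableau N (infuse (@linked n) (reading la) w).1.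
Proof.
move=> la_rho Kw sz; rewrite /shEqRect card_shape // -size_reading //.
by rewrite -boxes_reading (@iter_rect_step N la [::]).
Qed.

Lemma sumn_take_leq la i j : i <= j -> sumn (take i la) <= sumn (take j la).
Proof.
by move=> le_ij; rewrite -(subnKC le_ij) takeD sumn_cat leq_addr.
Qed.

Lemma sumn_takeS la i : sumn (take i.+1 la) = sumn (take i la) + nth 0 la i.
Proof.
have [lt_i|le_i] := ltnP i (size la); first by rewrite (take_nth 0) // sumn_rcons.
by rewrite nth_default // addn0 !take_oversize // ltnW.
Qed.

Lemma sorted_iota s : sorted ltn s -> all (fun i => i < size s) s -> s = iota 0 (size s).
Proof.
move=> s_sorted /allP s_lt.
apply: (irr_sorted_eq ltn_trans ltnn) (iota_ltn_sorted _ _) _ => //.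
have sub : {subset s <= iota 0 (size s)} by move=> i /s_lt; rewrite mem_iota.
have s_uniq := sorted_uniq ltn_trans ltnn s_sorted.
by case: (uniq_min_size s_uniq sub); rewrite ?size_iota.
Qed.

(** The labels of the superstandard tableau increase strictly in the reading order
    and are less than the number of boxes, so they are the positions in the reading
    word. *)
Lemma superstandard_reading mu :
  subshape mu (rho n) -> superstandard n mu = tableau (sumn mu) (reading mu).
Proof.
move=> mu_rho; pose f c := sumn (take c.1 mu) + (c.2 - c.1).
have f_lt c : c \in shape n mu -> f c < sumn (take c.1.+1 mu).
  by rewrite inE /f sumn_takeS => /andP[? ?]; lia.
(* The labels f c, in reading order, are 0, 1, 2 and so on. *)
have map_f : map f (reading_boxes mu) = iota 0 (sumn mu).
  rewrite -(size_reading_boxes mu_rho) -(size_map f); apply: sorted_iota.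
    rewrite sorted_map.
    apply: (sub_in_sorted (P := mem (shape n mu))) (sorted_reading mu).
      move=> c e c_mu e_mu; rewrite /= placeP => /orP[lt1|/andP[/eqP E lt2]].
        apply: leq_trans (f_lt _ c_mu) _.
        exact: leq_trans (sumn_take_leq _ lt1) (leq_addr _ _).
      by move: c_mu e_mu; rewrite /f E !inE; lia.
    by apply/allP => c; rewrite mem_reading_boxes.
  apply/allP => b /mapP[c]; rewrite mem_reading_boxes => c_mu ->.
  rewrite size_map size_reading_boxes //; apply: leq_trans (f_lt _ c_mu) _.
  by rewrite -[X in _ <= sumn X](cat_take_drop c.1.+1) sumn_cat leq_addr.
congr pair; apply/ffunP => c; rewrite !ffunE; last first.
  apply/setP => k; rewrite !inE; apply/esym/negP => /eqP Ek.
  have : nth (inr c) (reading mu) k \in reading mu by rewrite mem_nth ?size_reading.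
  by rewrite Ek => /mapP[].
rewrite /reading index_map; last by move=> ? ? [].
have [c_mu|c_mu] := boolP (c \in shape n mu); last first.
  by rewrite insubF // memNindex ?mem_reading_boxes // size_reading_boxes // ltnn.
rewrite -mem_reading_boxes in c_mu; congr insub; rewrite -[LHS]/(f c).
have lt_c : index c (reading_boxes mu) < sumn mu.
  by rewrite -size_reading_boxes // index_mem.
rewrite -{1}(nth_index c c_mu) -(nth_map _ 0) ?index_mem //.
by rewrite map_f nth_iota.
Qed.

End Shapes.

(** * Fillings counted by words, and the symmetry *)

Section Count.

Variable n : nat.
Implicit Types (c e : box n) (la mu nu : seq nat) (w p q : seq (site n)).
Implicit Types (K : {set box n}).

(** In a growth word a box occurs at most once, so its label is its position. *)
Lemma tableau_box N K w c (k : 'I_N) x0 :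
  growth K w -> size w = N -> nth x0 w k = inl c -> in_box (tableau N w) c = Some k.
Proof.
move=> Kw sz Ek; rewrite /in_box ffunE.
have lt_k : k < size w by rewrite sz.
move: Kw; rewrite -{1}(cat_take_drop k w) (drop_nth x0 lt_k) Ek.
case/growth_uniq_box=> _ cp _.
suff -> : index (inl c : site n) w = k by rewrite insubT //= => ?; congr Some; apply: val_inj.
rewrite -{1}(cat_take_drop k w) (drop_nth x0 lt_k) Ek index_cat (negPf cp) /= eqxx addn0.
by rewrite size_takel // ltnW.
Qed.

Lemma tableau_inj N K K' w w' :
    growth K w -> growth K' w' -> size w = N -> size w' = N ->
  tableau N w = tableau N w' -> w = w'.
Proof.
move=> Kw Kw' sz sz' E; case: w Kw sz E => [|x0 w0] Kw sz E.
  by apply/esym/size0nil; rewrite sz' -sz.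
apply: (@eq_from_nth _ x0); rewrite sz ?sz' // => k lt_k.
case Ek: (nth x0 _ k) => [c|i].
  have := tableau_box (k := Ordinal lt_k) Kw sz Ek; rewrite E => Tc.
  by have [_ ->] := in_tableau x0 sz' Tc.
have := on_tableau i (Ordinal lt_k) x0 sz; rewrite Ek eqxx E.
by rewrite (on_tableau _ _ x0 sz') => /eqP.
Qed.

(** Labels increase because the shape is lower closed at each step: a box weakly
    northwest of a new box or edge has been added earlier. *)
Lemma growth_shape_in N nu la w :
    strict_partition nu -> strict_partition la -> subshape la nu ->
    size w = N -> growth (shape n la) w -> shape n la :|: boxes w = shape n nu ->
  tableau N w \in eqShSYT n N nu la.
Proof.
move=> s_nu s_la la_nu sz Kw Ew.
have box_w c (k : 'I_N) : in_box (tableau N w) c = Some k ->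
    exists p q, [/\ w = p ++ inl c :: q, size p = k & c \notin shape n la].
  move=> Tc; have [_ Ek] := in_tableau (inl c) sz Tc.
  have lt_k : k < size w by rewrite sz.
  exists (take k w), (drop k.+1 w); have Ew' : w = take k w ++ inl c :: drop k.+1 w.
    by rewrite -Ek -drop_nth // cat_take_drop.
  split=> //; first by rewrite size_takel // ltnW.
  by move: Kw; rewrite Ew' => /growth_uniq_box[].
have reg_nu f : f \in shape n nu -> f.1 <= f.2 by rewrite inE => /andP[].
have before c e p x q (k : 'I_N) : w = p ++ x :: q ->
    in_box (tableau N w) c = Some k -> e \in shape n la :|: boxes (rcons p x) ->
    inl c != x -> c.1 <= e.1 -> c.2 <= e.2 -> k < size p.
  move=> Ew' Tc eK cx le1 le2; have [p' [q' [Ec sz_p' cK]]] := box_w _ _ Tc.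
  have Kp : growth (shape n la) (rcons p x).
    by move: Kw; rewrite Ew' -cat_rcons growth_cat => /andP[].
  have c_nu : c \in shape n nu by rewrite -Ew Ec !inE mem_cat mem_head !orbT.
  have e_nu : e \in shape n nu.
    by rewrite -Ew Ew' -cat_rcons boxes_cat setUA inE eK.
  have clK := lower_closed_growth (lower_closed_shape s_la) Kp.
  have := lower_closed_le clK eK (reg_nu _ e_nu) (reg_nu _ c_nu) le1 le2.
  rewrite in_setU (negPf cK) inE /= mem_rcons in_cons (negPf cx) /= => cp.
  have [<- _] := in_tableau (inl c) sz Tc.
  by rewrite Ew' index_cat cp index_mem.
have box_before c e (k l : 'I_N) : in_box (tableau N w) c = Some k ->
    in_box (tableau N w) e = Some l -> c != e -> c.1 <= e.1 -> c.2 <= e.2 -> k < l.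
  move=> Tc /box_w[p [q [Ew' <- _]]] ce le1 le2.
  apply: (before _ e _ _ _ _ Ew' Tc) => //.
  by rewrite !inE mem_rcons mem_head orbT.
have edge_w i (k : 'I_N) : k \in on_edge (tableau N w) i ->
    exists p q, w = p ++ inr i :: q /\ size p = k.
  rewrite (on_tableau _ _ (inr i) sz) => /eqP Ek.
  have lt_k : k < size w by rewrite sz.
  exists (take k w), (drop k.+1 w); split; last by rewrite size_takel // ltnW.
  by rewrite -[X in _ ++ X :: _]Ek -drop_nth // cat_take_drop.
have edge_in i p q : w = p ++ inr i :: q -> (i, i) \in shape n la :|: boxes p.
  move=> Ew'; have : growth (shape n la) (p ++ inr i :: q) by rewrite -Ew'.
  by move=> /growth_split addp; apply: (addable_next addp) => //=.
rewrite inE; apply/and4P; split.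
- apply/forallP => c; rewrite -Ew; apply/eqP.
  rewrite in_setD in_setU andb_orr andNb orFb [c \in boxes w]inE.
  case Tc: (in_box _ c) => [k|].
    by have [p [q [-> _ ->]]] := box_w _ _ Tc; rewrite mem_cat mem_head orbT.
  apply/esym; apply/negP => /andP[_]; rewrite -index_mem sz => lt_k.
  by move: Tc; rewrite /in_box ffunE insubT.
- apply/forallP => i; apply/implyP; apply: contraR => /set0Pn[k /edge_w[p [q [Ew' _]]]].
  by have := edge_in _ _ _ Ew'; rewrite -Ew Ew' boxes_cat !inE => /orP[->|->]; rewrite ?orbT.
- apply/forallP => k; have lt_k : k < size w by rewrite sz.
  have x0 : site n by case: (w) lt_k => [|x ?].
  case Ek: (nth x0 w k) => [c|i].
    have -> : [set e | in_box (tableau N w) e == Some k] = [set c].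
      apply/setP => e; rewrite !inE; apply/eqP/eqP => [Te|->].
        by have [_] := in_tableau x0 sz Te; rewrite Ek => -[].
      exact: tableau_box Kw sz Ek.
    have -> : [set i | k \in on_edge (tableau N w) i] = set0.
      by apply/setP => i; rewrite inE (on_tableau _ _ x0 sz) Ek !inE.
    by rewrite cards1 cards0.
  have -> : [set e | in_box (tableau N w) e == Some k] = set0.
    apply/setP => e; rewrite !inE; apply/eqP => Te.
    by have [_] := in_tableau x0 sz Te; rewrite Ek.
  have -> : [set j | k \in on_edge (tableau N w) j] = [set i].
    by apply/setP => j; rewrite inE (on_tableau _ _ x0 sz) Ek !inE eq_sym.
  by rewrite cards1 cards0.
apply/and3P; split.
- apply/'forall_'forall_'forall_'forall_implyP => c e k l /and4P[/eqP Tc /eqP Te /eqP E lt2].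
  apply: (box_before _ _ _ _ Tc Te); rewrite ?E //; last exact: ltnW.
  by apply: contraTneq lt2 => ->; rewrite ltnn.
- apply/'forall_'forall_'forall_'forall_implyP => c e k l /and4P[/eqP Tc /eqP Te /eqP E lt1].
  apply: (box_before _ _ _ _ Tc Te); rewrite ?E //; last exact: ltnW.
  by apply: contraTneq lt1 => ->; rewrite ltnn.
apply/'forall_'forall_'forall_implyP => c k l /andP[/eqP Tc /edge_w[p [q [Ew' <-]]]].
apply: (before c (c.2, c.2) p (inr c.2) q) => //=.
  by have := edge_in _ _ _ Ew'; rewrite !inE mem_rcons in_cons.
have [p' [q' [Ec _ _]]] := box_w _ _ Tc; apply: reg_nu.
by rewrite -Ew Ec !inE mem_cat mem_head !orbT.
Qed.

(** The word of T lists the sites of the labels in increasing order. *)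
Lemma eqShSYT_growth N nu la (T : filling n N) :
    strict_partition nu -> subshape la nu -> T \in eqShSYT n N nu la ->
  exists w, [/\ size w = N, growth (shape n la) w,
    shape n la :|: boxes w = shape n nu & T = tableau N w].
Proof.
move=> s_nu la_nu; rewrite inE => /and4P[/forallP filled /forallP in_nu /forallP once].
case/and3P=> rows cols edges.
have sub_nu : shape n la \subset shape n nu.
  apply/subsetP => c; rewrite !inE => /andP[-> lt_c]; apply: leq_trans lt_c _.
  by rewrite leq_add2r subshape_nth.
(* The site of a label exists and is unique by the condition labels_once. *)
pose at_site (k : 'I_N) (x : site n) : bool :=
  match x with inl c => in_box T c == Some k | inr i => k \in on_edge T i end.
have at_inj k x y : at_site k x -> at_site k y -> x = y.
  have /eqP := once k; set A := [set c | _]; set B := [set i | _] => AB.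
  have inA c : at_site k (inl c) -> c \in A by rewrite inE.
  have inB i : at_site k (inr i) -> i \in B by rewrite inE.
  have gtA c : c \in A -> 0 < #|A| by move=> cA; rewrite card_gt0; apply/set0Pn; exists c.
  have gtB i : i \in B -> 0 < #|B| by move=> iB; rewrite card_gt0; apply/set0Pn; exists i.
  case: x y => [c|i] [e|j].
  - move=> /inA cA /inA eA; congr inl; apply: (card_le1_eqP (A := A)) => //; lia.
  - by move=> /inA/gtA cA /inB/gtB jB; lia.
  - by move=> /inB/gtB jB /inA/gtA cA; lia.
  move=> /inB cA /inB eA; congr inr; apply: (card_le1_eqP (A := B)) => //; lia.
have [f at_f] : exists f : 'I_N -> site n, forall k, at_site k (f k).
  apply: (@fin_all_exists _ (fun=> site n) at_site) => k.
  have /eqP := once k; set A := [set c | _]; set B := [set i | _] => AB.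
  have [A0|[c]] := set_0Vmem A; last by rewrite inE; exists (inl c).
  have [B0|[i]] := set_0Vmem B; last by rewrite inE; exists (inr i).
  by rewrite A0 B0 !cards0 in AB.
pose w := [seq f k | k <- enum 'I_N].
have sz : size w = N by rewrite size_map size_enum_ord.
have nth_w x0 (k : 'I_N) : nth x0 w k = f k.
  by rewrite (nth_map k) ?size_enum_ord // nth_ord_enum.
have mem_w p x q : w = p ++ x :: q -> exists k : 'I_N, size p = k /\ at_site k x.
  move=> Ew; have lt_p : size p < N by rewrite -sz Ew size_cat /=; lia.
  exists (Ordinal lt_p); split=> //.
  suff -> : x = f (Ordinal lt_p) by [].
  by rewrite -(nth_w x) Ew nth_cat ltnn subnn.
have prefix_box p q c (k : 'I_N) :
    w = p ++ q -> in_box T c = Some k -> (inl c \in p) = (k < size p).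
  move=> Ew /eqP Tc; have Ek := at_inj k _ (inl c) (at_f k) Tc.
  apply/idP/idP => [/splitPr cp|lt_k].
    case: cp Ew => p1 p2; rewrite -catA cat_cons => /mem_w[l [sz_p1 Tl]].
    have : Some l = Some k by rewrite -(eqP Tl) -(eqP Tc).
    by case=> <-; rewrite size_cat /= -sz_p1 -addSnnS leq_addr.
  have := nth_w (f k) k; rewrite Ew nth_cat lt_k Ek => <-.
  by rewrite mem_nth.
have prefix_Some p q c : w = p ++ q -> inl c \in p -> isSome (in_box T c).
  move=> Ew /splitPr cp; case: cp Ew => p1 p2.
  by rewrite -catA cat_cons => /mem_w[l [_ /eqP->]].
have w_box c : (inl c \in w) = isSome (in_box T c).
  case Tc: (in_box T c) => [k|].
    by rewrite (@prefix_box w [::] c k) ?cats0 // sz ltn_ord.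
  by apply/negP => /(@prefix_Some w [::]); rewrite cats0 Tc => /(_ erefl).
exists w; split=> //.
- apply: growthP => p x q Ew; have [k [sz_p kx]] := mem_w _ _ _ Ew.
  have below_x d (l : 'I_N) : in_box T d = Some l -> l < k -> d \in boxes p.
    by move=> Td lt_l; rewrite inE (prefix_box _ _ _ _ Ew Td) sz_p.
  (* A box of nu whose label, if any, is less than k is in the shape before step k. *)
  have filled_before d : d \in shape n nu -> (forall l : 'I_N, in_box T d = Some l -> l < k) ->
      d \in shape n la :|: boxes p.
    move=> d_nu lt_k; rewrite in_setU; have := filled d; rewrite in_setD d_nu andbT.
    case: (d \in shape n la) => //= /eqP; case Td: (in_box T d) => [l|] // _.
    by apply: (below_x _ _ Td); apply: lt_k.
  rewrite /addable; case: x kx Ew => [c|i] kx Ew.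
    have /eqP := filled c; rewrite (eqP kx) => /esym; rewrite in_setD => /andP[c_la c_nu].
    move: (c_nu); rewrite inE => /andP[le_c _]; rewrite le_c in_setU (negPf c_la) inE.
    rewrite (prefix_box _ _ _ _ Ew (eqP kx)) sz_p ltnn /=.
    apply/forallP => d; apply/implyP => /andP[le_d dc].
    apply: filled_before; first exact: lower_closed_shape s_nu _ _ le_d dc c_nu.
    move=> l Td; case/orP: dc => /andP[/eqP E1 /eqP E2].
      move/'forall_'forall_'forall_'forall_implyP: rows => /(_ d c l k); apply.
      by rewrite Td (eqP kx) -val_eqE /= E1 -E2 !eqxx ltnSn.
    move/'forall_'forall_'forall_'forall_implyP: cols => /(_ d c l k); apply.
    by rewrite Td (eqP kx) -val_eqE /= E1 -E2 !eqxx ltnSn.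
  apply/forallP => d; apply/implyP => /andP[_ /eqP ->].
  apply: filled_before => [|l Td].
    have := in_nu i; apply: contraLR => ->; rewrite /=; apply/set0Pn; exists k.
    exact: kx.
  move/'forall_'forall_'forall_implyP: edges => /(_ (i, i) l k); apply.
  by rewrite Td eqxx.
- apply/setP => c; rewrite in_setU [c \in boxes w]inE w_box (eqP (filled c)) in_setD.
  by case: (boolP (c \in shape n la)) => //= /(subsetP sub_nu).
rewrite [T]surjective_pairing; congr pair; apply/ffunP.
  move=> c; rewrite ffunE -[LHS]/(in_box T c); have := w_box c.
  case Tc: (in_box T c) => [k|] /= cw; last first.
    by rewrite insubF // memNindex ?cw // sz ltnn.
  have lt_c : index (inl c : site n) w < N by rewrite -sz index_mem cw.
  have := at_f (Ordinal lt_c).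
  by rewrite -(nth_w (inl c)) nth_index ?cw //= Tc insubT => /eqP.
move=> i; rewrite ffunE; apply/setP => k; rewrite inE (nth_w (inr i)).
apply/idP/eqP => [ki|Ek]; first exact: (at_inj k _ (inr i) (at_f k) ki).
by have := at_f k; rewrite Ek.
Qed.

(** The words counted here start from the empty shape, with the reading word of la
    as a prefix, so la is contained in nu as soon as one such word exists. *)
Lemma d_card la mu nu :
    strict_partition la -> strict_partition mu -> strict_partition nu ->
    subshape la (rho n) -> subshape mu (rho n) ->
  d n la mu nu =
  #|[set w : (sumn mu).-tuple (site n) |
      [&& growth set0 (reading n la ++ w),
          boxes (reading n la ++ w) == shape n nu &
          (infuse (@linked n) (reading n la) w).1 == reading n mu]]|.
Proof.
move=> s_la s_mu s_nu la_rho mu_rho; set A := [set w : _.-tuple _ | _].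
have split_growth w : growth set0 (reading n la ++ w) = growth (shape n la) w.
  by rewrite growth_cat growth_reading // set0U boxes_reading.
have split_boxes w : boxes (reading n la ++ w) = shape n la :|: boxes w.
  by rewrite boxes_cat boxes_reading.
rewrite /d; case: ifP => la_nu; last first.
  apply/esym/eqP; rewrite cards_eq0; apply/eqP/setP => w; rewrite !inE.
  apply/negP => /and3P[_ /eqP Ew _]; case/negP: la_nu.
  by rewrite (@subshapeP n) // -Ew split_boxes subsetUl.
have inj_A : {in A &, injective (fun w : (sumn mu).-tuple (site n) => tableau (sumn mu) w)}.
  move=> w w'; rewrite !inE !split_growth => /andP[Kw _] /andP[Kw' _] E.
  by apply: val_inj; apply: tableau_inj Kw Kw' _ _ E; rewrite size_tuple.
rewrite -(card_in_imset inj_A); apply: eq_card => T; rewrite inE.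
have rect_eq w : size w = sumn mu -> growth (shape n la) w ->
    (shEqRect la (tableau (sumn mu) w) == superstandard n mu) =
    ((infuse (@linked n) (reading n la) w).1 == reading n mu).
  move=> sz Kw; rewrite shEqRect_tableau ?split_growth // superstandard_reading //.
  apply/eqP/eqP => [|-> //].
  have : growth set0 (reading n la ++ w) by rewrite split_growth.
  move/growth_infuse; rewrite growth_cat => /andP[Kw' _].
  by apply: tableau_inj Kw' (growth_reading n s_mu) _ _; rewrite ?size_infuse1 ?size_reading.
apply/andP/imsetP => [[/(eqShSYT_growth s_nu la_nu)[w [sz Kw Ew ->]]]|[w]].
  rewrite rect_eq // => Erect; have sz' : size w == sumn mu by apply/eqP.
  exists (Tuple sz') => //; rewrite inE /= split_growth Kw split_boxes Ew eqxx.
  exact: Erect.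
rewrite inE split_growth split_boxes => /and3P[Kw /eqP Ew Erect] ->.
by rewrite rect_eq ?size_tuple // growth_shape_in ?size_tuple.
Qed.

Lemma d_leq la mu nu :
    strict_partition la -> strict_partition mu -> strict_partition nu ->
    subshape la (rho n) -> subshape mu (rho n) ->
  d n la mu nu <= d n mu la nu.
Proof.
move=> s_la s_mu s_nu la_rho mu_rho; rewrite !d_card //.
set A := [set w : _.-tuple _ | _]; set B := [set w : _.-tuple _ | _].
pose u := (infuse (@linked n) (reading n la)).
have sz_u (w : seq (site n)) : size (u w).2 == sumn la.
  by rewrite size_infuse2 size_reading.
pose f (w : (sumn mu).-tuple (site n)) := Tuple (sz_u w).
have inj_f : {in A &, injective f}.
  move=> w w'; rewrite !inE => /and3P[_ _ /eqP Ew] /and3P[_ _ /eqP Ew'] /(congr1 val) /= E.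
  have K1 := infuseK (@linked_sym n) (reading n la) w.
  have := infuseK (@linked_sym n) (reading n la) w'.
  by rewrite Ew' -/(u w') -E -Ew K1 => -[/val_inj].
(* The image of w is a word counted by B, by infusing back. *)
rewrite -(card_in_imset inj_f); apply/subset_leq_card/subsetP => _ /imsetP[w + ->].
rewrite !inE /= => /and3P[Kw /eqP Ew /eqP Emu].
have Kw' := growth_infuse Kw; rewrite Emu in Kw'.
have Kb := boxes_perm (infuse_perm (reading n la) w); rewrite Emu in Kb.
have K1 := infuseK (@linked_sym n) (reading n la) w; rewrite Emu in K1.
by rewrite Kw' Kb Ew K1 !eqxx.
Qed.

Lemma d_sym la mu nu :
    strict_partition la -> strict_partition mu -> strict_partition nu ->
    subshape la (rho n) -> subshape mu (rho n) ->
  d n la mu nu = d n mu la nu.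
Proof. by move=> *; apply/eqP; rewrite eqn_leq !d_leq. Qed.

End Count.

Lemma D_sym n la mu nu :
    strict_partition la -> strict_partition mu -> strict_partition nu ->
    subshape la (rho n) -> subshape mu (rho n) ->
  D n la mu nu = D n mu la nu.
Proof.
move=> s_la s_mu s_nu la_rho mu_rho; rewrite /D.
have -> : Delta nu la mu = Delta nu mu la by rewrite /Delta (GRing.addrC (Posz (sumn la))).
have -> : L nu la mu = L nu mu la by rewrite /L (GRing.addrC (Posz (size la))).
by rewrite d_sym.
Qed.

Theorem theorem9p5 (n : nat) (hn : 1 <= n) :
  (forall la mu nu : seq nat,
     strict_partition la -> strict_partition mu -> strict_partition nu ->
     subshape la (rho n) -> subshape mu (rho n) -> subshape nu (rho n) ->
     D n la mu nu = D n mu la nu)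
  /\ (forall x y : R n, star x y = star y x).
Proof.
split=> [la mu nu s_la s_mu s_nu la_rho mu_rho _|x y]; first exact: D_sym.
have partsP (la : SP n) : strict_partition (parts la) /\ subshape (parts la) (rho n).
  by apply/andP; apply: (valP la).
rewrite /star exchange_big; apply: eq_bigr => mu _; apply: eq_bigr => la _.
rewrite GRing.mulrC; congr GRing.scale; apply: eq_bigr => nu _; congr GRing.scale.
by case: (partsP la) (partsP mu) (partsP nu) => ? ? [? ?] [? ?]; apply: D_sym.
Qed.
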